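(* Let $\beta$ be a Parry number with Parry polynomial $n_\beta^*(X)$. If $\xi$ is a beta-conjugate of $\beta$ which is not an algebraic unit, then its multiplicity $\nu_\xi$ as a root of $n_\beta^*(X)$ satisfies $$\nu_\xi\leq\frac{1}{\log 2}\Big(\log\big({\rm H}(n_\beta^* )\big)-\log|N(\beta)|\Big).$$ Moreover, if $|N(\beta)|\geq {\rm H}(n_\beta^* )/3$, then all beta-conjugates of $\beta$ which are not units (if any) are simple roots of $n_\beta^*(X)$.
   Context: For non-integer $\beta>1$, let $d_\beta(1)=0.t_1t_2\ldots$ with $t_1=\lfloor\beta\rfloor$, $t_{j+1}=\lfloor\beta T_\beta^j(1)\rfloor$, $T_\beta(x)=\beta x-\lfloor\beta x\rfloor$; $\beta$ is a Parry number if $(t_i)$ is eventually periodic. Parry polynomial: if $t_i=0$ for $i>m$, $t_m\neq0$: $n_\beta^*(X)=X^m-\sum_{i=1}^mt_iX^{m-i}$; otherwise with minimal preperiod $m\ge0$ and period $p+1$: if $m\ge1$, $n_\beta^*(X)=X^{m+p+1}-\sum_{i=1}^{m+p+1}t_iX^{m+p+1-i}-X^m+\sum_{i=1}^mt_iX^{m-i}$; if $m=0$, $n_\beta^*(X)=X^{p+1}-\sum_{i=1}^pt_iX^{p+1-i}-(1+t_{p+1})$. It is monic in $\mathbb{Z}[X]$ and divisible by the minimal polynomial $P_\beta$ of $\beta$. A beta-conjugate of $\beta$ is a root of $n_\beta^*$ that is not a root of $P_\beta$. ${\rm H}$ denotes the height (maximum modulus of the coefficients), and $N(\beta)$ the algebraic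 norm (product of all Galois conjugates of $\beta$, including $\beta$). *)

(* Defs.v *)
From mathcomp Require Import all_boot all_order all_algebra.
From mathcomp Require Import complex.
From mathcomp Require Import reals exp.

Set Implicit Arguments.
Unset Strict Implicit.
Unset Printing Implicit Defensive.

Import Order.TTheory GRing.Theory Num.Theory.

Local Open Scope ring_scope.

Definition beta_transform (R : realType) (beta x : R) : R :=
  beta * x - (Num.floor (beta * x))%:~R.

(* Digits are indexed from 1: [renyi_digit beta j.+1] is t_(j+1); the value at
   index 0 is meaningless and never used. *)
Definition renyi_digit (R : realType) (beta : R) (i : nat) : int :=
  Num.floor (beta * iter i.-1 (beta_transform beta) 1).

Definition periodic_after (t : nat -> int) (m p : nat) : Prop :=
  forall i, (m < i)%N -> t (i + p.+1)%N = t i.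

Definition parry_number (R : realType) (beta : R) : Prop :=
  [/\ 1 < beta, beta \isn't a Num.int
    & exists m p, periodic_after (renyi_digit beta) m p].

Definition finite_length (t : nat -> int) (m : nat) : Prop :=
  [/\ (0 < m)%N, t m != 0 & forall i, (m < i)%N -> t i = 0].

(* The least preperiod is the same for all periods and the least period the
   same for all preperiods, so the two minimality conditions are compatible. *)
Definition minimal_preperiod_period (t : nat -> int) (m p : nat) : Prop :=
  periodic_after t m p /\
  forall m' p', periodic_after t m' p' -> (m <= m')%N /\ (p <= p')%N.

Definition parry_poly_finite (t : nat -> int) (m : nat) : {poly int} :=
  'X^m - \sum_(1 <= i < m.+1) t i *: 'X^(m - i).

Definition parry_poly_preperiodic (t : nat -> int) (m p : nat) : {poly int} :=
  'X^(m + p + 1) - \sum_(1 <= i < (m + p + 1).+1) t i *: 'X^(m + p + 1 - i)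
  - 'X^m + \sum_(1 <= i < m.+1) t i *: 'X^(m - i).

Definition parry_poly_periodic (t : nat -> int) (p : nat) : {poly int} :=
  'X^(p.+1) - \sum_(1 <= i < p.+1) t i *: 'X^(p.+1 - i) - (1 + t p.+1)%:P.

Variant is_parry_polynomial (R : realType) (beta : R) : {poly int} -> Prop :=
| ParryFinite (m : nat) :
    finite_length (renyi_digit beta) m ->
    is_parry_polynomial beta (parry_poly_finite (renyi_digit beta) m)
| ParryPreperiodic (m p : nat) :
    ~ (exists k, finite_length (renyi_digit beta) k) ->
    minimal_preperiod_period (renyi_digit beta) m p ->
    (1 <= m)%N ->
    is_parry_polynomial beta (parry_poly_preperiodic (renyi_digit beta) m p)
| ParryPeriodic (p : nat) :
    ~ (exists k, finite_length (renyi_digit beta) k) ->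
    minimal_preperiod_period (renyi_digit beta) 0 p ->
    is_parry_polynomial beta (parry_poly_periodic (renyi_digit beta) p).

Definition is_minimal_polynomial (R : realType) (beta : R)
    (P : {poly rat}) : Prop :=
  [/\ P \is monic, root (map_poly ratr P) beta
    & forall q : {poly rat},
        q != 0 -> root (map_poly ratr q) beta -> (size P <= size q)%N].

Definition height (p : {poly int}) : nat := (\max_(i < size p) absz (p`_i)%R)%N.

(* The complex roots of P, listed with multiplicity. *)
Definition galois_conjugates (R : realType) (P : {poly rat}) : seq R[i] :=
  sval (closed_field_poly_normal (map_poly (ratr : rat -> R[i]) P)).

(* For P the minimal polynomial of beta, this is the algebraic norm of beta. *)
Definition alg_norm (R : realType) (P : {poly rat}) : R[i] :=
  \prod_(z <- galois_conjugates R P) z.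

Definition beta_conjugate (R : realType) (n : {poly int}) (P : {poly rat})
    (xi : R[i]) : Prop :=
  root (map_poly (intr : int -> R[i]) n) xi /\
  ~~ root (map_poly (ratr : rat -> R[i]) P) xi.

Definition algebraic_unit (R : realType) (xi : R[i]) : Prop :=
  [/\ xi != 0, integralOver (intr : int -> R[i]) xi
    & integralOver (intr : int -> R[i]) xi^-1].

Definition root_multiplicity (R : realType) (n : {poly int}) (xi : R[i]) : nat :=
  mup xi (map_poly (intr : int -> R[i]) n).

(* Main.v *)
Require Import Defs.
From mathcomp Require Import all_boot all_order all_algebra.
From mathcomp Require Import separable fieldext algebraics_fundamentals.
From mathcomp Require Import complex boolp reals exp.
From mathcomp Require Import zify ring lra.

Set Implicit Arguments.
Unset Strict Implicit.
Unset Printing Implicit Defensive.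

Import Order.TTheory GRing.Theory Num.Theory.

Local Open Scope ring_scope.

(** Put D_k = X^k - t_1 X^(k-1) - ... - t_k, that is [parry_poly_finite t k], so
    that D_k(beta) = T^k(1). Every Parry polynomial [n] is either D_m or
    D_(m+p+1) - D_m; it is monic, vanishes at [beta] because the orbit of 1 is
    eventually 0 or eventually periodic, and its constant term is nonzero by
    minimality of the preperiod. If [P] and [Q] are the minimal polynomials of
    [beta] and of a beta-conjugate [xi] of multiplicity [nu], separability of
    [Q] and [P.[xi] != 0] give [Q ^+ nu * P %| n], and by Gauss's lemma this
    holds in Z[X]. Hence |Q(0)|^nu |N(beta)| is at most |n(0)|, thus at most the
    height of [n]; and |Q(0)| >= 2, since otherwise [xi] would be a unit. *)

Lemma bernoulli_le_exprn (R : realDomainType) (x : R) k :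
  1 <= x -> 1 + (x - 1) *+ k <= x ^+ k.
Proof.
move=> x_ge1; elim: k => [|k IH]; first by rewrite addr0.
have xk_ge1 : 1 <= x ^+ k by exact: exprn_ege1.
by rewrite exprS mulrS; nra.
Qed.

Lemma exprn_unbounded (R : archiRealFieldType) (x M : R) :
  1 < x -> exists k, M < x ^+ k.
Proof.
rewrite -subr_gt0 => x1_gt0; exists (Num.bound (M / (x - 1))).
apply: lt_le_trans (bernoulli_le_exprn _ _); last by lra.
apply: ltr_wpDl => //; rewrite -mulr_natr -ltr_pdivrMl // mulrC.
exact: unstable.ltr_bound.
Qed.

Lemma le_nat_div_ln (R : realType) (b x y : R) k :
  1 < b -> 0 < x -> b ^+ k * x <= y -> k%:R <= (ln b)^-1 * (ln y - ln x).
Proof.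
move=> b_gt1 x_gt0 bkx_le_y.
have bk_gt0 : 0 < b ^+ k by rewrite exprn_gt0 //; lra.
rewrite ler_pdivlMl ?ln_gt0 // lerBrDr mulr_natr -lnXn; last by lra.
rewrite -lnM ?posrE // ler_ln ?posrE ?mulr_gt0 //.
exact: lt_le_trans (mulr_gt0 bk_gt0 x_gt0) bkx_le_y.
Qed.

Lemma mupX (F : fieldType) (x : F) (p : {poly F}) k :
  p != 0 -> mup x (p ^+ k) = (k * mup x p)%N.
Proof.
move=> p_neq0; elim: k => [|k IH]; first by rewrite mupNroot ?root1.
by rewrite exprS mupM ?expf_neq0 // IH mulSn.
Qed.

Lemma mup_gt0 (F : fieldType) (x : F) (p : {poly F}) :
  p != 0 -> (0 < mup x p)%N = root p x.
Proof. by move=> p_neq0; rewrite -XsubC_dvd // -root_factor_theorem. Qed.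

Lemma mup_separable (F : fieldType) (x : F) (p : {poly F}) :
  separable_poly p -> root p x -> mup x p = 1%N.
Proof.
move=> p_sep /factor_theorem[q p_def].
move: p_sep; rewrite p_def separable_root => /andP[_ qNx].
by rewrite mupMr // -(expr1 ('X - _)) mup_XsubCX eqxx.
Qed.

Lemma irredp_separable (F : fieldType) (p : {poly F}) :
  [pchar F] =i pred0 -> irreducible_poly p -> separable_poly p.
Proof.
move=> /pcharf0P char0 p_irr; have [p_gt1 _] := p_irr.
have p_neq0 := irredp_neq0 p_irr.
have deg_gt0 : (0 < (size p).-1)%N by rewrite -subn1 subn_gt0.
have deriv_neq0 : p^`() != 0.
  apply/eqP => /(congr1 (coefp (size p).-2)) /eqP.
  rewrite /= coef0 coef_deriv prednK // -lead_coefE -mulr_natr mulf_eq0.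
  by rewrite lead_coef_eq0 (negPf p_neq0) char0 -leqn0 leqNgt deg_gt0.
rewrite unlock irreducible_poly_coprime //.
apply: contraL (lt_size_deriv p_neq0) => /(dvdp_leq deriv_neq0).
by rewrite -leqNgt.
Qed.

Section IrreducibleRoot.

Variables (F L : fieldType) (iota : {rmorphism F -> L}) (p : {poly F}) (z : L).
Hypotheses (p_irr : irreducible_poly p) (pz : root (map_poly iota p) z).

Lemma irredp_dvdp_root (q : {poly F}) :
  (p %| q) = root (map_poly iota q) z.
Proof.
apply/idP/idP => [/dvdpP[r ->]|qz]; first by rewrite rmorphM rootM pz orbT.
apply: contraLR qz; rewrite -irreducible_poly_coprime // -(coprimep_map iota).
by move=> /coprimep_root/(_ pz).
Qed.

Lemma irredp_exp_mup_dvdp (q : {poly F}) :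
  separable_poly p -> q != 0 -> p ^+ mup z (map_poly iota q) %| q.
Proof.
move=> p_sep q_neq0; have p_neq0 := irredp_neq0 p_irr.
have p_simple : mup z (map_poly iota p) = 1%N.
  by rewrite mup_separable // separable_map.
suff exp_dvdp k : (k <= mup z (map_poly iota q))%N -> p ^+ k %| q.
  exact: exp_dvdp.
elim: k => [|k IH] k_lt; first exact: dvd1p.
have /dvdpP[r q_def] := IH (ltnW k_lt).
move: q_neq0 k_lt; rewrite q_def mulf_eq0 negb_or => /andP[r_neq0 pk_neq0].
rewrite rmorphM rmorphXn /= mupM ?expf_neq0 ?map_poly_eq0 //.
rewrite mupX ?map_poly_eq0 // p_simple muln1 -[ltnLHS]add0n ltn_add2r.
by rewrite mup_gt0 ?map_poly_eq0 // -irredp_dvdp_root exprS dvdp_mul2r.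
Qed.

End IrreducibleRoot.

Lemma map_ratr_intr (L : numFieldType) (q : {poly int}) :
  map_poly (ratr : rat -> L) (map_poly intr q) = map_poly intr q.
Proof.
by rewrite -map_poly_comp; apply: eq_map_poly => c /=; rewrite ratr_int.
Qed.

Lemma monic_dvdp_rat_int (P : {poly rat}) (n : {poly int}) :
    P \is monic -> n \is monic -> P %| map_poly intr n ->
  exists2 p : {poly int}, p \is monic & P = map_poly intr p.
Proof.
move=> P_monic n_monic /dvdpP_rat_int[p [a a_neq0 P_def] [r n_def]].
have lp_unit : lead_coef p \is a GRing.unit.
  apply/unitrPr; exists (lead_coef r).
  by rewrite -lead_coefM -n_def (monicP n_monic).
have a_lp : a * (lead_coef p)%:~R = 1.
  have := monicP P_monic.
  by rewrite P_def lead_coefZ lead_coef_map_inj //; exact: intr_inj.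
have a_def : a = ((lead_coef p)^-1)%:~R.
  by rewrite rmorphV // (canRL (mulrK (rmorph_unit intr lp_unit)) a_lp) mul1r.
exists ((lead_coef p)^-1 *: p); first by rewrite monicE lead_coefZ mulVr.
by rewrite map_polyZ P_def a_def.
Qed.

Lemma integralOver_irreducible_root (L : closedFieldType) (F : fieldType)
    (iota : {rmorphism F -> L}) (z : L) :
  integralOver iota z ->
  exists p, [/\ p \is monic, root (map_poly iota p) z & irreducible_poly p].
Proof.
move=> z_int.
have iota_dec : decidable_embedding iota by move=> y; exact: pselect.
by have [p p_min] := minPoly_decidable_closure iota_dec z_int; exists p.
Qed.

Lemma integralOver_inv_root (A : comUnitRingType) (L : fieldType)
    (f : {rmorphism A -> L}) (q : {poly A}) (z : L) :
    q \is monic -> q`_0 \is a GRing.unit -> root (map_poly f q) z ->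
  z != 0 /\ integralOver f z^-1.
Proof.
move=> q_monic; elim/poly_ind: q q_monic => [|a c _] q_monic.
  by rewrite coef0 unitr0.
rewrite coefD coefMX coefC add0r => c_unit qz.
have fc_neq0 : f c != 0 by rewrite -unitfE rmorph_unit.
have az : (map_poly f a).[z] * z = - f c.
  apply/eqP; rewrite -addr_eq0; move: qz.
  by rewrite rmorphD rmorphM /= map_polyX map_polyC /root hornerMXaddC.
have z_neq0 : z != 0.
  by apply: contraNneq fc_neq0 => z0; rewrite -oppr_eq0 -az z0 mulr0.
split=> //; have -> : z^-1 = (map_poly f a).[z] * f (- c^-1).
  apply: (mulIf z_neq0); rewrite mulVf // mulrAC az.
  by rewrite mulNr rmorphN rmorphV // mulrN opprK mulfV.
apply: integral_mul (integral_id _ _); apply: integral_horner; last first.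
  by exists (a * 'X + c%:P).
by apply/integral_poly => i; rewrite coef_map; exact: integral_id.
Qed.

Lemma monic_int_exp_mup_dvdp (L : numClosedFieldType) (r : {poly int}) (z : L) :
    r \is monic -> root (map_poly intr r) z ->
  exists q : {poly int}, [/\ q \is monic, root (map_poly intr q) z
    & q ^+ mup z (map_poly intr r) %| r].
Proof.
move=> r_monic rz; pose rQ : {poly rat} := map_poly intr r.
have rQ_monic : rQ \is monic by exact: monic_map.
have z_int : integralOver (ratr : rat -> L) z.
  by exists rQ; rewrite ?map_ratr_intr.
have [Q [Q_monic Qz Q_irr]] := integralOver_irreducible_root z_int.
have Q_dvd : Q %| rQ by rewrite (irredp_dvdp_root Q_irr Qz) map_ratr_intr.
have [q q_monic Q_def] := monic_dvdp_rat_int Q_monic r_monic Q_dvd.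
exists q; split=> //; first by move: Qz; rewrite Q_def map_ratr_intr.
have Q_sep := irredp_separable (pchar_num _) Q_irr.
have := irredp_exp_mup_dvdp Q_irr Qz Q_sep (monic_neq0 rQ_monic).
by rewrite map_ratr_intr Q_def -rmorphXn dvdp_rat_int.
Qed.

Lemma monic_int_exp_mupM_dvdp (L : numClosedFieldType) (n p : {poly int})
    (z : L) :
    n \is monic -> p \is monic -> p %| n ->
    root (map_poly intr n) z -> ~~ root (map_poly intr p) z ->
  exists q : {poly int}, [/\ q \is monic, root (map_poly intr q) z
    & q ^+ mup z (map_poly intr n) * p %| n].
Proof.
move=> n_monic p_monic /(Pdiv.IdomainMonic.dvdpP p_monic)[r n_def] nz pNz.
have r_monic : r \is monic by rewrite -(monicMr _ p_monic) -n_def.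
have rz : root (map_poly intr r) z.
  by move: nz; rewrite n_def rmorphM rootM (negPf pNz) orbF.
have [q [q_monic qz q_dvd]] := monic_int_exp_mup_dvdp r_monic rz.
by exists q; rewrite n_def rmorphM mupMl // dvdp_mul2r ?monic_neq0.
Qed.

Section BetaTransform.

Variables (R : realType) (beta : R).
Local Notation T := (beta_transform beta).
Local Notation t := (renyi_digit beta).

Lemma beta_transform_itv x : 0 <= T x < 1.
Proof.
by have := floor_itv (beta * x); rewrite /beta_transform intrD; lra.
Qed.

Lemma beta_transform0 : T 0 = 0.
Proof. by rewrite /beta_transform mulr0 floor0 subrr. Qed.

Lemma renyi_digit_iter m k :
  t (m + k).+1 = Num.floor (beta * iter k T (iter m T 1)).
Proof. by rewrite /renyi_digit addnC iterD. Qed.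

Hypothesis beta_gt1 : 1 < beta.

Let beta_gt0 : 0 < beta.
Proof. exact: lt_trans beta_gt1. Qed.

Lemma renyi_digit_ge0 i : (0 < i)%N -> 0 <= t i.
Proof.
case: i => // i _; rewrite floor_ge0 mulr_ge0 ?(ltW beta_gt0) //=.
by case: i => [|i] //=; case/andP: (beta_transform_itv (iter i T 1)).
Qed.

(* [T] multiplies distances by [beta] as long as the digits agree, while the
   orbits stay in [0, 1). *)
Lemma beta_digits_inj x y :
    (forall k, Num.floor (beta * iter k T x) = Num.floor (beta * iter k T y)) ->
  x = y.
Proof.
move=> same_digits; apply/eqP; apply: contraT => x_neq_y.
have iter_distance k : iter k T x - iter k T y = beta ^+ k * (x - y).
  elim: k => [|k IH]; first by rewrite mul1r.
  by rewrite !iterS /beta_transform same_digits exprS -mulrA -IH; ring.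
have d_gt0 : 0 < `|x - y| by rewrite normr_gt0 subr_eq0.
have [k] := exprn_unbounded `|x - y|^-1 beta_gt1.
rewrite -div1r ltr_pdivrMr // => far_apart.
have bk_gt0 : 0 < beta ^+ k by rewrite exprn_gt0.
have : 1 < `|iter k.+1 T x - iter k.+1 T y|.
  rewrite iter_distance normrM gtr0_norm ?exprn_gt0 // exprS -mulrA.
  by rewrite (lt_trans far_apart) // ltr_pMl ?mulr_gt0.
have := beta_transform_itv (iter k T x).
have := beta_transform_itv (iter k T y).
by rewrite !iterS ltr_normr; lra.
Qed.

Lemma periodic_after_iter m p :
  periodic_after t m p -> iter (m + p.+1) T 1 = iter m T 1.
Proof.
move=> per; apply: beta_digits_inj => k.
by rewrite -!renyi_digit_iter addnAC -addSn per // ltnS leq_addr.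
Qed.

Lemma finite_length_iter m : finite_length t m -> iter m T 1 = 0.
Proof.
move=> [_ _ digit0]; apply: beta_digits_inj => k.
rewrite -renyi_digit_iter digit0 ?ltnS ?leq_addr //.
by rewrite iter_fix ?beta_transform0 // mulr0 floor0.
Qed.

End BetaTransform.

Section ParryPolynomial.

Variable t : nat -> int.
Local Notation D := (parry_poly_finite t).

Lemma parry_poly_finite0 : D 0 = 1.
Proof. by rewrite /parry_poly_finite big_geq // subr0. Qed.

Lemma parry_poly_finiteS k : D k.+1 = D k * 'X - (t k.+1)%:P.
Proof.
rewrite /parry_poly_finite big_nat_recr //= subnn alg_polyC opprD addrA.
congr (_ - _); rewrite mulrBl -exprSr mulr_suml; congr (_ - _).
by apply: eq_big_nat => i /andP[_ i_le_k]; rewrite -scalerAl -exprSr subSn.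
Qed.

Lemma parry_poly_preperiodicE m p :
  parry_poly_preperiodic t m p = D (m + p.+1) - D m.
Proof. by rewrite /parry_poly_preperiodic addn1 -addnS opprB addrA addrAC. Qed.

Lemma parry_poly_periodicE p : parry_poly_periodic t p = D p.+1 - D 0.
Proof.
rewrite parry_poly_finite0 /parry_poly_periodic /parry_poly_finite.
rewrite [in RHS]big_nat_recr //= subnn alg_polyC polyCD.
by rewrite !opprD !addrA addrAC.
Qed.

Lemma size_parry_poly_finite k : size (D k) = k.+1.
Proof.
elim: k => [|k IH]; first by rewrite parry_poly_finite0 size_poly1.
by rewrite parry_poly_finiteS -polyCN size_MXaddC -size_poly_eq0 IH.
Qed.

Lemma parry_poly_finite_monic k : D k \is monic.
Proof.
elim: k => [|k IH]; first by rewrite parry_poly_finite0 monic1.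
rewrite monicE parry_poly_finiteS lead_coefDl ?lead_coefMX //.
rewrite size_polyN size_mulX ?monic_neq0 // size_parry_poly_finite.
exact: leq_ltn_trans (size_polyC_leq1 _) _.
Qed.

Lemma parry_poly_finiteB_monic m k : (m < k)%N -> D k - D m \is monic.
Proof.
move=> m_lt_k; rewrite monicE lead_coefDl; first exact: parry_poly_finite_monic.
by rewrite size_polyN !size_parry_poly_finite.
Qed.

Lemma coef0_parry_poly_finite k : (0 < k)%N -> (D k)`_0 = - t k.
Proof.
by case: k => // k _; rewrite parry_poly_finiteS coefB coefMX coefC sub0r.
Qed.

Lemma minimal_preperiod_digit_neq m p :
  minimal_preperiod_period t m.+1 p -> t (m.+1 + p.+1) != t m.+1.
Proof.
move=> [per minimal]; apply/eqP => same_digit.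
suff /minimal[] : periodic_after t m p by rewrite ltnn.
move=> i; rewrite leq_eqVlt => /predU1P[<- //|]; exact: per.
Qed.

End ParryPolynomial.

Section ParryPolynomialOfBeta.

Variables (R : realType) (beta : R) (n : {poly int}).
Hypothesis parry_n : is_parry_polynomial beta n.
Local Notation t := (renyi_digit beta).
Local Notation D := (parry_poly_finite t).

Lemma parry_polynomial_cases :
  (exists2 m, finite_length t m & n = D m) \/
  (exists m p, minimal_preperiod_period t m p /\ n = D (m + p.+1) - D m).
Proof.
case: parry_n => [m fin|m p _ per _|p _ per]; first by left; exists m.
  by right; exists m, p; rewrite parry_poly_preperiodicE.
by right; exists 0%N, p; rewrite parry_poly_periodicE.
Qed.

Lemma parry_polynomial_monic : n \is monic.
Proof.
have [[m _ ->]|[m [p [_ ->]]]] := parry_polynomial_cases.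
  exact: parry_poly_finite_monic.
by apply: parry_poly_finiteB_monic; rewrite addnS ltnS leq_addr.
Qed.

Lemma horner_parry_poly_finite k :
  (map_poly intr (D k)).[beta] = iter k (beta_transform beta) 1.
Proof.
elim: k => [|k IH]; first by rewrite parry_poly_finite0 rmorph1 hornerC.
rewrite parry_poly_finiteS rmorphB rmorphM /= map_polyX map_polyC /=.
by rewrite hornerD hornerN hornerMX hornerC IH mulrC.
Qed.

Hypothesis beta_gt1 : 1 < beta.

Lemma parry_polynomial_root : root (map_poly intr n) beta.
Proof.
apply/rootP; have [[m fin ->]|[m [p [[per _] ->]]]] := parry_polynomial_cases.
  by rewrite horner_parry_poly_finite finite_length_iter.
rewrite rmorphB /= hornerD hornerN !horner_parry_poly_finite.
by rewrite periodic_after_iter // subrr.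
Qed.

Lemma parry_polynomial_coef0_neq0 : n`_0 != 0.
Proof.
have [[m [m_gt0 tm_neq0 _] ->]|] := parry_polynomial_cases.
  by rewrite coef0_parry_poly_finite // oppr_eq0.
move=> [[|m] [p [min_per ->]]]; rewrite coefB coef0_parry_poly_finite //.
  rewrite parry_poly_finite0 coef1 add0n.
  by have := renyi_digit_ge0 beta_gt1 (ltn0Sn p); lia.
rewrite coef0_parry_poly_finite // subr_eq0 eqr_opp.
exact: minimal_preperiod_digit_neq.
Qed.

End ParryPolynomialOfBeta.

Lemma nonunit_root_coef0_gt1 (R : realType) (q : {poly int}) (xi : R[i]) :
    q \is monic -> root (map_poly intr q) xi -> ~ algebraic_unit xi ->
  q`_0 != 0 -> (1 < absz (q`_0)%R)%N.
Proof.
move=> q_monic qxi xi_nonunit q0_neq0.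
rewrite ltn_neqAle absz_gt0 q0_neq0 andbT; apply/eqP => q0_abs1.
apply: xi_nonunit.
have q0_unit : q`_0 \is a GRing.unit by apply/unitrPr; exists q`_0; nia.
have [xi_neq0 xiV_int] := integralOver_inv_root q_monic q0_unit qxi.
by split=> //; exists q.
Qed.

Lemma coef0_le_height (n : {poly int}) : (absz (n`_0)%R <= height n)%N.
Proof.
have [sz0|sz_gt0] := posnP (size n); last exact: (leq_bigmax (Ordinal sz_gt0)).
by rewrite nth_default ?sz0.
Qed.

Lemma coef0_monic_dvdp_le_height (d n : {poly int}) :
  d \is monic -> d %| n -> n`_0 != 0 -> (0 < absz (d`_0)%R <= height n)%N.
Proof.
move=> d_monic /(Pdiv.IdomainMonic.dvdpP d_monic)[r n_def] n0_neq0.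
have n0_def : absz n`_0 = (absz (r`_0)%R * absz (d`_0)%R)%N.
  by rewrite n_def -!horner_coef0 hornerM abszM.
move: n0_neq0 (coef0_le_height n); rewrite -absz_gt0 n0_def muln_gt0.
by move=> /andP[r0_gt0 ->]; apply: leq_trans; exact: leq_pmull.
Qed.

Lemma alg_normE (R : realType) (P : {poly rat}) : P \is monic ->
  alg_norm R P = (-1) ^+ (size P).-1 * ratr P`_0.
Proof.
move=> P_monic; rewrite /alg_norm /galois_conjugates.
case: closed_field_poly_normal => s /=.
rewrite lead_coef_map (monicP P_monic) rmorph1 scale1r => P_split.
have -> : size P = (size s).+1.
  by rewrite -(size_map_poly (ratr : rat -> R[i])) P_split size_prod_XsubC.
by rewrite -coef_map P_split coef0_prod_XsubC signrMK.
Qed.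

Lemma normc_alg_norm_int (R : realType) (p : {poly int}) : p \is monic ->
  ComplexField.Normc.normc (alg_norm R (map_poly intr p)) = (absz (p`_0)%R)%:R.
Proof.
move=> p_monic; rewrite alg_normE ?monic_map //; apply: complexI.
rewrite -[LHS]/`|_ * _ : R[i]| normrM normrX normrN1 expr1n mul1r.
by rewrite coef_map ratr_int -intr_norm -natr_absz rmorph_nat.
Qed.

Lemma is_minimal_polynomial_irreducible (R : realType) (beta : R)
    (P : {poly rat}) :
  is_minimal_polynomial beta P -> irreducible_poly P.
Proof.
move=> [P_monic P_beta P_min].
by apply/(subfx_irreducibleP P_beta (monic_neq0 P_monic)) => q qz /P_min; exact.
Qed.

Lemma root_multiplicity_gt0 (R : realType) (n : {poly int}) (xi : R[i]) :
  n != 0 -> (0 < root_multiplicity n xi)%N = root (map_poly intr n) xi.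
Proof.
by move=> n_neq0; rewrite mup_gt0 // map_poly_eq0_id0 ?intr_eq0 ?lead_coef_eq0.
Qed.

Section MultiplicityBound.

Variables (R : realType) (beta : R) (n : {poly int}) (P : {poly rat}).
Hypotheses (n_monic : n \is monic) (n0_neq0 : n`_0 != 0).
Hypotheses (n_beta : root (map_poly intr n) beta).
Hypothesis (P_min : is_minimal_polynomial beta P).

Lemma is_minimal_polynomial_int_dvdp :
  exists p : {poly int}, [/\ p \is monic, p %| n & P = map_poly intr p].
Proof.
have [P_monic P_beta _] := P_min.
have P_dvd : P %| map_poly intr n.
  have P_irr := is_minimal_polynomial_irreducible P_min.
  by rewrite (irredp_dvdp_root P_irr P_beta) map_ratr_intr.
have [p p_monic P_def] := monic_dvdp_rat_int P_monic n_monic P_dvd.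
by exists p; split=> //; rewrite -dvdp_rat_int -P_def.
Qed.

Lemma normc_alg_norm_gt0 : 0 < ComplexField.Normc.normc (alg_norm R P).
Proof.
have [p [p_monic p_dvd ->]] := is_minimal_polynomial_int_dvdp.
rewrite normc_alg_norm_int // ltr0n.
by have /andP[] := coef0_monic_dvdp_le_height p_monic p_dvd n0_neq0.
Qed.

Lemma exp_root_multiplicity_le_height (xi : R[i]) :
    beta_conjugate n P xi -> ~ algebraic_unit xi ->
  2 ^+ root_multiplicity n xi * ComplexField.Normc.normc (alg_norm R P)
    <= (height n)%:R.
Proof.
move=> [nxi PNxi] xi_nonunit.
have [p [p_monic p_dvd P_def]] := is_minimal_polynomial_int_dvdp.
rewrite {}P_def map_ratr_intr normc_alg_norm_int // in PNxi *.
have [q [q_monic qxi]] :=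
  monic_int_exp_mupM_dvdp n_monic p_monic p_dvd nxi PNxi.
rewrite -/(root_multiplicity n xi) => qp_dvd.
have nu_gt0 : (0 < root_multiplicity n xi)%N.
  by rewrite root_multiplicity_gt0 ?monic_neq0.
have qp_monic : q ^+ root_multiplicity n xi * p \is monic.
  by rewrite monicMr // monic_exp.
have := coef0_monic_dvdp_le_height qp_monic qp_dvd n0_neq0.
rewrite -horner_coef0 hornerM horner_exp !horner_coef0 abszM abszX.
rewrite muln_gt0 expn_gt0 (gtn_eqF nu_gt0) orbF absz_gt0.
move=> /andP[/andP[q0_neq0 _] le_height].
rewrite -natrX -natrM ler_nat (leq_trans _ le_height) // leq_mul2r leq_exp2r //.
by rewrite (nonunit_root_coef0_gt1 q_monic qxi) ?orbT.
Qed.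

End MultiplicityBound.

Theorem theorem3p7 (R : realType) (beta : R) (n : {poly int}) (P : {poly rat})
    (hbeta : parry_number beta)
    (hn : is_parry_polynomial beta n)
    (hP : is_minimal_polynomial beta P) :
  (forall xi : R[i], beta_conjugate n P xi -> ~ algebraic_unit xi ->
     (root_multiplicity n xi)%:R
       <= (ln 2)^-1 * (ln ((height n)%:R : R) - ln (ComplexField.Normc.normc (alg_norm R P)))) /\
  ((height n)%:R / 3 <= ComplexField.Normc.normc (alg_norm R P) ->
     forall xi : R[i], beta_conjugate n P xi -> ~ algebraic_unit xi ->
       root_multiplicity n xi = 1%N).
Proof.
have [beta_gt1 _ _] := hbeta.
have n_monic := parry_polynomial_monic hn.
have n0_neq0 := parry_polynomial_coef0_neq0 hn beta_gt1.
have n_beta := parry_polynomial_root hn beta_gt1.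
have norm_gt0 := normc_alg_norm_gt0 n_monic n0_neq0 n_beta hP.
have mult_bound := exp_root_multiplicity_le_height n_monic n0_neq0 n_beta hP.
split=> [xi xi_conj xi_nonunit|norm_ge xi xi_conj xi_nonunit].
  by apply: le_nat_div_ln; rewrite ?ltr1n //; exact: mult_bound.
have mult_gt0 : (0 < root_multiplicity n xi)%N.
  by rewrite root_multiplicity_gt0 ?monic_neq0 //; case: xi_conj.
have mult_lt2 : (root_multiplicity n xi < 2)%N.
  rewrite -(ltn_exp2l _ _ (ltnSn 1)) -(ltr_nat R) natrX -(ltr_pM2r norm_gt0).
  by apply: le_lt_trans (mult_bound _ xi_conj xi_nonunit) _; lra.
by lia.
Qed.
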